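(* Let $p>1$ and $x,y\in(0,\pi_p/2)$. Then the following inequalities hold: (1) $L(\sin_p(x),\sin_p(y))\leq \sin_p(L(x,y))$ for every $p>1$; (2) $L(\cos_p(x),\cos_p(y))\leq \cos_p(L(x,y))$ for every $p\geq 2$.
   Context: For $p>1$, let $\arcsin_p(x)=\int_0^x(1-t^p)^{-1/p}\,dt$ for $x\in[0,1]$, and $\pi_p=2\arcsin_p(1)=\frac{2\pi}{p\sin(\pi/p)}$. The function $\sin_p:[0,\pi_p/2]\to[0,1]$ is the inverse of $\arcsin_p$, and $\cos_p(x)=\frac{d}{dx}\sin_p(x)=(1-\sin_p(x)^p)^{1/p}$ for $x\in[0,\pi_p/2]$. For positive reals $a\neq b$, the logarithmic mean is $L(a,b)=\frac{a-b}{\log a-\log b}$; by convention $L(a,a)=a$. *)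

(* Defs.v *)
From HB Require Import structures.
From mathcomp Require Import all_boot all_order all_algebra.
From mathcomp Require Import all_classical all_reals all_analysis.
Set Implicit Arguments.
Unset Strict Implicit.
Unset Printing Implicit Defensive.
Import Order.TTheory GRing.Theory Num.Theory.
Import numFieldNormedType.Exports.
Local Open Scope classical_set_scope.
Local Open Scope ring_scope.

(* The integrand is singular at t = 1, but it is Lebesgue integrable on
   [0, 1] when p > 1, so [arcsin_p p 1] is the value of the improper integral. *)
Definition arcsin_p {R : realType} (p x : R) : R :=
  \int[@lebesgue_measure R]_(t in `[0, x]) (1 - t `^ p) `^ (- p^-1).

Definition pi_p {R : realType} (p : R) : R := 2 * arcsin_p p 1.

(* Inverse of the restriction of [arcsin_p p] to [0, 1]; only meaningful for
   0 <= x <= pi_p p / 2. *)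
Definition sin_p {R : realType} (p x : R) : R :=
  get [set s | 0 <= s <= 1 /\ arcsin_p p s = x].

(* Two-sided derivative: only meaningful for 0 < x < pi_p p / 2, since [sin_p p]
   is not extended beyond [0, pi_p p / 2]. *)
Definition cos_p {R : realType} (p x : R) : R := derive1 (sin_p p) x.

Definition logmean {R : realType} (a b : R) : R :=
  if a == b then a else (a - b) / (ln a - ln b).

(* Main.v *)
(* If f is positive and concave on an interval of positive reals and
   u |-> ln f(e^u) is concave too, then L(f x, f y) <= f(L(x, y)).  Concavity of
   ln f(e^u) means that x f'(x) / f(x) is nonincreasing.  Both conditions hold
   for sin_p, and for cos_p if p >= 2, since sin_p' = cos_p and
   cos_p' = - sin_p^(p-1) cos_p^(2-p). *)

Require Import Defs.
From mathcomp Require Import all_boot all_order all_algebra.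
From mathcomp Require Import all_classical all_reals all_analysis.
From mathcomp Require Import measurable_realfun ring lra.
Import Order.TTheory GRing.Theory Num.Theory.
Import numFieldNormedType.Exports.
Local Open Scope ring_scope.

(** * Mean value theorem, tangent bounds and concavity *)

Lemma scaleRE {R : realType} (a b : R) : a *: b = a * b.
Proof. by []. Qed.

Lemma is_derive_continuous {R : realType} (f : R -> R) (x l : R) :
  is_derive x 1 f l -> {for x, continuous f}.
Proof.
by move=> [fx _]; apply: differentiable_continuous; apply/derivable1_diffP.
Qed.

Lemma MVT_itv {R : realType} (f df : R -> R) (i : interval R) :
  {in i, forall x : R, is_derive x 1 f (df x)} ->
  {in i &, forall x y, x < y ->
    exists2 c, c \in `]x, y[ & f y - f x = df c * (y - x)}.
Proof.
move=> fD x y xi yi xy.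
have sub c : c \in `[x, y] -> c \in i.
  rewrite in_itv/= => cxy.
  exact: (interval_is_interval xi yi).
apply: (@MVT R f df) => //.
  by move=> c cxy; apply/fD/sub/(subset_itv_oo_cc cxy).
apply: derivable_within_continuous => c /sub ci.
by have [] := fD c ci.
Qed.

Lemma nonincreasing_derive_le_tangent {R : realType} (f df : R -> R)
    (i : interval R) :
  {in i, forall x : R, is_derive x 1 f (df x)} ->
  {in i &, {homo df : x y / x <= y >-> y <= x}} ->
  {in i &, forall x y, f y <= f x + df x * (y - x)}.
Proof.
move=> fD dfdec x y xi yi.
have [xy|yx|<-] := ltgtP x y; last by rewrite subrr mulr0 addr0.
- have [c cxy fE] := MVT_itv _ _ _ fD _ _ xi yi xy.
  move: cxy; rewrite in_itv/= => /andP[xc cy].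
  have ci : c \in i.
    by apply: (interval_is_interval xi yi); rewrite (ltW xc) (ltW cy).
  rewrite -lerBlDl fE ler_pM2r ?subr_gt0//.
  exact: dfdec (ltW xc).
- have [c cxy fE] := MVT_itv _ _ _ fD _ _ yi xi yx.
  move: cxy; rewrite in_itv/= => /andP[yc cx].
  have ci : c \in i.
    by apply: (interval_is_interval yi xi); rewrite (ltW yc) (ltW cx).
  have : df x * (x - y) <= df c * (x - y).
    by rewrite ler_pM2r ?subr_gt0//; exact: dfdec (ltW cx).
  lra.
Qed.

(** The values at [u] and [v] lie below the tangent at the intermediate point; in their weighted
    average the linear terms cancel. *)
Lemma nonincreasing_derive_concave {R : realType} (f df : R -> R)
    (i : interval R) :
  {in i, forall x : R, is_derive x 1 f (df x)} ->
  {in i &, {homo df : x y / x <= y >-> y <= x}} ->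
  {in i &, forall u v, forall t, 0 <= t <= 1 ->
    (1 - t) * f u + t * f v <= f (u + t * (v - u))}.
Proof.
move=> fD dfdec u v ui vi t t01.
set w := u + _.
have wi : w \in i.
  have [uv|vu] := leP u v.
    by apply: (interval_is_interval ui vi); rewrite /w; apply/andP; split; nra.
  by apply: (interval_is_interval vi ui); rewrite /w; apply/andP; split; nra.
have := nonincreasing_derive_le_tangent _ _ _ fD dfdec _ _ wi ui.
have := nonincreasing_derive_le_tangent _ _ _ fD dfdec _ _ wi vi.
rewrite /w; move: (f _) (df _) => a b; nra.
Qed.

(** * The logarithmic mean *)

Lemma logmean_expR {R : realType} (u v : R) : u != v ->
  logmean (expR u) (expR v) = (expR v - expR u) / (v - u).
Proof.
move=> uv; rewrite /logmean ifF; last first.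
  by apply/negbTE; apply: contra uv => /eqP/expR_inj ->.
rewrite !expRK -[in LHS](opprB (expR v)) -[in LHS](opprB v).
by rewrite invrN mulrNN.
Qed.

(** In logarithmic coordinates the mean is a difference quotient of [expR], hence equal to [expR c]
    for some [c] between [ln x] and [ln y]. *)
Lemma logmean_itv {R : realType} (i : interval R) :
  {in i, forall x, 0 < x} -> {in i &, forall x y, logmean x y \in i}.
Proof.
move=> i0 x y xi yi.
wlog xy : x y xi yi / x <= y => [h|].
  have [|/ltW yx] := leP x y; first exact: h.
  have := h _ _ yi xi yx.
  suff -> : logmean y x = logmean x y by [].
  rewrite /logmean eq_sym; case: eqP => [->//|_].
  by rewrite -[in LHS](opprB x) -[in LHS](opprB (ln x)) invrN mulrNN.
move: xy; rewrite le_eqVlt => /predU1P[<-|xy]; first by rewrite /logmean eqxx.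
have x0 := i0 _ xi; have y0 := i0 _ yi.
have lxy : ln x < ln y by rewrite ltr_ln// posrE.
rewrite -(lnK x0) -(lnK y0) logmean_expR ?lt_eqF//.
have [c] := MVT_itv expR expR `]-oo, +oo[ (fun x _ => is_derive_expR x)
  (ln x) (ln y) erefl erefl lxy.
rewrite in_itv/= => /andP[xc cy] ->.
rewrite mulfK ?subr_eq0 ?gt_eqF//.
apply: (interval_is_interval xi yi).
by rewrite -[x]lnK// -[y]lnK// !ler_expR !ltW.
Qed.

Lemma is_derive_expR_affine {R : realType} (a b t : R) :
  is_derive t 1 (fun s : R => expR (a + s * b)) (b * expR (a + t * b)).
Proof.
have D1 : is_derive t 1 (fun s : R => a + s * b) b.
  have -> : (fun s : R => a + s * b) = cst a + b \*: id.
    by apply/funext => s; rewrite !fctE /= scaleRE mulrC.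
  by apply: is_derive_eq; rewrite scaleRE; ring.
have D2 := @is_derive1_comp R expR _ t _ _ (is_derive_expR _) D1.
by apply: (is_derive_eq D2); rewrite mulrC.
Qed.

(* Along the geometric path z t = x^(1-t) y^t from x to y, geometric concavity
   and concavity give f(x)^(1-t) f(y)^t <= f(z t) <= f(m) + f'(m) (z t - m) with
   m = L(x, y).  Integrating over [0, 1] turns the left-hand side into
   L(f(x), f(y)), and the linear term vanishes since z has mean m. *)
Lemma logmean_le {R : realType} (f df : R -> R) (i : interval R) :
  {in i, forall x, 0 < x} -> {in i, forall x, 0 < f x} ->
  {in i &, injective f} ->
  {in i, forall x : R, is_derive x 1 f (df x)} ->
  {in i &, {homo df : x y / x <= y >-> y <= x}} ->
  {in i &, {homo (fun x => x * df x / f x) : x y / x <= y >-> y <= x}} ->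
  {in i &, forall x y, logmean (f x) (f y) <= f (logmean x y)}.
Proof.
move=> i0 f0 fI fD dfdec gdec x y xi yi.
have [<-|xy] := eqVneq x y; first by rewrite /logmean !eqxx.
have x0 := i0 _ xi; have y0 := i0 _ yi.
pose u := ln x; pose v := ln y; pose a := ln (f x); pose b := ln (f y).
have uv : u != v by apply: contra xy => /eqP/ln_inj-> //; rewrite posrE.
(* Injectivity of [f] puts [logmean (f x) (f y)] in its quotient case and permits division by
   [b - a]. *)
have ab : a != b.
  apply: contra xy => /eqP/ln_inj; rewrite !posrE => /(_ (f0 _ xi) (f0 _ yi)).
  by move/fI => ->.
have xE : x = expR u by rewrite lnK.
have yE : y = expR v by rewrite lnK.
have mi := logmean_itv _ i0 _ _ xi yi.
set m := logmean x y in mi *.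
have mE : m = (expR v - expR u) / (v - u) by rewrite -logmean_expR// -xE -yE.
have LE : logmean (f x) (f y) = (expR b - expR a) / (b - a).
  by rewrite -logmean_expR// !lnK// posrE; apply: f0.
pose I := `[Num.min u v, Num.max u v].
have uI : u \in I by rewrite in_itv/= ge_min le_max !lexx.
have vI : v \in I by rewrite in_itv/= ge_min le_max !lexx !orbT.
have Ii w : w \in I -> expR w \in i.
  rewrite in_itv/=; have [uv'|vu'] := leP u v => uwv.
    by apply: (interval_is_interval xi yi); rewrite xE yE !ler_expR.
  by apply: (interval_is_interval yi xi); rewrite xE yE !ler_expR.
pose z (t : R) := expR (u + t * (v - u)); pose k := df m.
have zi (t : R) : 0 <= t <= 1 -> z t \in i.
  move=> t01; apply: Ii; rewrite in_itv/=.
  by have [uv'|vu'] := leP u v; apply/andP; split; nra.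
(* The derivative of w |-> ln f(e^w) is x f'(x) / f(x) at x = e^w, so [gdec] makes this function
   concave. *)
have lnfD : {in I, forall w : R, is_derive w 1 (fun w : R => ln (f (expR w)))
    (expR w * df (expR w) / f (expR w))}.
  move=> w /Ii wi; have fw0 := f0 _ wi.
  have fwD := fD _ wi.
  have D1 := is_derive_expR w.
  have D2 := is_derive1_comp fwD D1.
  have D3 := is_derive1_comp (is_derive1_ln fw0) D2.
  by apply: (is_derive_eq D3); rewrite mulrC (mulrC (df _)).
have lnfdec : {in I &, {homo (fun w : R => expR w * df (expR w) / f (expR w)) :
    w1 w2 / w1 <= w2 >-> w2 <= w1}}.
  by move=> w1 w2 w1I w2I w12; apply: gdec; rewrite ?Ii ?ler_expR.
have geo (t : R) : 0 <= t <= 1 -> expR (a + t * (b - a)) <= f (z t).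
  move=> t01; rewrite -[leRHS]lnK ?posrE ?f0 ?zi// ler_expR.
  have := nonincreasing_derive_concave _ _ _ lnfD lnfdec _ _ uI vI _ t01.
  rewrite -xE -yE -/a -/b -/(z t).
  lra.
(* [H] is an explicit antiderivative of the gap [dH] between the tangent of [f] at [m], taken at
   [z t], and the geometric interpolation of [f x] and [f y]. The mean value theorem on [0, 1] then
   replaces integration: H(1) - H(0) = dH(c) >= 0. *)
pose H (t : R) := f m * t + k * (z t / (v - u) - m * t)
  - expR (a + t * (b - a)) / (b - a).
pose dH t := f m + k * (z t - m) - expR (a + t * (b - a)).
have HD (t : R) : is_derive t 1 H (dH t).
  have Hz := is_derive_expR_affine u (v - u) t.
  have Hab := is_derive_expR_affine a (b - a) t.
  have E : H = (f m \*: id + k \*: ((v - u)^-1 \*: z - m \*: id)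
      - (b - a)^-1 \*: (fun s => expR (a + s * (b - a)))).
    by apply/funext => s; rewrite /H !fctE /= !scaleRE; ring.
  rewrite E; apply: is_derive_eq.
  rewrite /dH /z !scaleRE; field.
  by rewrite !subr_eq0 !(eq_sym v) !(eq_sym b) uv ab.
have [c c01 HE] := MVT_itv H dH `]-oo, +oo[ (fun x _ => HD x)
  0 1 erefl erefl ltr01.
have : 0 <= dH c.
  have c01' : 0 <= c <= 1.
    by move: c01; rewrite in_itv/= => /andP[/ltW-> /ltW->].
  rewrite subr_ge0 (le_trans (geo _ c01'))//.
  exact: nonincreasing_derive_le_tangent fD dfdec _ _ mi (zi _ c01').
move: HE; rewrite subr0 mulr1 => <-.
(* In H(1) - H(0) the coefficient of [k] is (e^v - e^u) / (v - u) - m = 0, which leaves f(m) -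
   L(f(x), f(y)). *)
rewrite LE /H /z mE !mul0r !mul1r !mulr0 !addr0 !mulr1.
rewrite !(addrC u) !(addrC a) !subrK.
rewrite !mulrBl; lra.
Qed.

(** * Real powers *)

Lemma powR_lt1 {R : realType} (p s : R) : 0 < p -> 0 <= s < 1 -> s `^ p < 1.
Proof.
move=> p0 /andP[s0 s1].
have : s `^ p < 1 `^ p by apply: gt0_ltr_powR; rewrite ?nnegrE.
by rewrite powR1.
Qed.

Lemma powR_le1 {R : realType} (p s : R) : 0 <= p -> 0 <= s <= 1 -> s `^ p <= 1.
Proof.
move=> p0 /andP[s0 s1].
have : s `^ p <= 1 `^ p by apply: ge0_ler_powR; rewrite ?nnegrE.
by rewrite powR1.
Qed.

Lemma powR_nonincreasing {R : realType} (q a b : R) :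
  q <= 0 -> 0 < a -> a <= b -> b `^ q <= a `^ q.
Proof.
move=> q0 a0 ab; have b0 := lt_le_trans a0 ab.
rewrite -(opprK q) (powRN a) (powRN b) lef_pV2 ?posrE ?powR_gt0//.
by apply: ge0_ler_powR; rewrite ?nnegrE ?oppr_ge0// ltW.
Qed.

(** Used with q = -1/p for continuity of the integrand and with q = 1/p to differentiate [cos_p]. *)
Lemma is_derive1_one_sub_powR {R : realType} (p q s : R) :
    0 < s -> s `^ p < 1 ->
  is_derive s 1 (fun t => (1 - t `^ p) `^ q)
    (- (q * (1 - s `^ p) `^ (q - 1) * (p * s `^ (p - 1)))).
Proof.
move=> s0 sp1; have w0 : 0 < 1 - s `^ p by rewrite subr_gt0.
have D1 : is_derive s 1 (fun t : R => 1 - t `^ p) (- (p * s `^ (p - 1))).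
  have D := is_deriveB (is_derive_cst (1 : R) s 1) (is_derive1_powR p s0).
  by apply: (is_derive_eq D); rewrite sub0r.
have D2 := @is_derive1_comp R (fun t => t `^ q) _ s _ _ (is_derive1_powR q w0) D1.
by apply: (is_derive_eq D2); rewrite mulrN.
Qed.

(** * Generalized sine and cosine *)

Section arcsin_p_theory.
Context {R : realType} (p : R).
Hypothesis p1 : 1 < p.
(* Equivalent to integrability of the integrand on [0, 1], since the real-valued
   integral of a nonnegative non-integrable function is the junk value 0. *)
Hypothesis A1_gt0 : 0 < arcsin_p p 1.

Let p0 : 0 < p. Proof. exact: lt_trans ltr01 p1. Qed.
Let h (t : R) : R := (1 - t `^ p) `^ (- p^-1).

Lemma arcsin_p_integrand_integrable :
  (@lebesgue_measure R).-integrable `[(0 : R), 1]%classic (EFin \o h).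
Proof.
apply/integrableP; split.
  apply/measurable_EFinP; apply: (measurableT_comp (measurable_powR _)).
  by apply: measurable_funB => //; apply: measurable_funTS;
    exact: measurable_powR.
under eq_integral do rewrite /= ger0_norm ?powR_ge0//.
move: A1_gt0; rewrite /arcsin_p /Rintegral -/h.
by case: (integral _ _ _) => [r| |]; rewrite ?ltxx ?ltry.
Qed.

Lemma is_derive_arcsin_p (s : R) : 0 < s < 1 ->
  is_derive s 1 (arcsin_p p) (h s).
Proof.
move=> /andP[s0 s1].
have hD := is_derive1_one_sub_powR p (- p^-1) s s0 (powR_lt1 p s p0 _).
have [] := continuous_FTC1_closed s1 arcsin_p_integrand_integrable s0.
  by apply: is_derive_continuous; apply: hD; rewrite s1 ltW.
by rewrite derive1E => D E; exact: DeriveDef.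
Qed.

Lemma arcsin_p_continuous : {within `[0, 1], continuous (arcsin_p p)}%classic.
Proof.
exact: parameterized_integral_continuous ler01 arcsin_p_integrand_integrable.
Qed.

Lemma arcsin_p0 : arcsin_p p 0 = 0.
Proof. by rewrite /arcsin_p set_itv1 Rintegral_set1. Qed.

(** The integrand is at least 1, having base in (0, 1] and a negative exponent. This yields both
    strict monotonicity and sin_p(x) <= x. *)
Lemma arcsin_p_expand (a b : R) : 0 <= a -> a < b -> b <= 1 ->
  b - a <= arcsin_p p b - arcsin_p p a.
Proof.
move=> a0 ab b1.
have sub c : c \in `]a, b[ -> 0 < c < 1.
  by rewrite in_itv/= => /andP[ac cb]; rewrite (le_lt_trans a0) ?(lt_le_trans cb).
(* [b] may be 1, where the integrand is singular, so differentiability is asked only inside and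
   continuity supplies the endpoints. *)
have [] := @MVT R (arcsin_p p) h a b ab.
- by move=> c /sub; exact: is_derive_arcsin_p.
- apply: continuous_subspaceW arcsin_p_continuous => c /=.
  by rewrite !in_itv/= => /andP[ac cb]; rewrite (le_trans a0) ?(le_trans cb).
move=> c /sub /andP[c0 c1] ->.
rewrite ler_peMl ?subr_ge0 ?(ltW ab)//.
rewrite -(powRr0 (1 - c `^ p)) /h.
have cp1 : c `^ p < 1 by rewrite powR_lt1// c1 ltW.
apply: ger_powR; rewrite ?oppr_le0 ?invr_ge0 ?(ltW p0)//.
by rewrite subr_gt0 cp1 gerBl powR_ge0.
Qed.

Lemma arcsin_p_ltr : {in `[0, 1] &, {mono arcsin_p p : a b / a < b}}.
Proof.
suff incr : {in `[0, 1] &, {homo arcsin_p p : a b / a < b}}.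
  by apply: leW_mono_in; apply: le_mono_in.
move=> a b; rewrite !in_itv/= => /andP[a0 _] /andP[_ b1] ab.
by rewrite -subr_gt0 (lt_le_trans _ (arcsin_p_expand _ _ a0 ab b1))// subr_gt0.
Qed.

(** By strict monotonicity the set in the definition of [sin_p] is a singleton, so [get] returns its
    element. *)
Lemma arcsin_pK : {in `[0, 1], cancel (arcsin_p p) (sin_p p)}.
Proof.
move=> s s01; apply: get_unique => [|t]; first by move: s01; rewrite in_itv.
move=> [t01 E].
have := arcsin_p_ltr t s; have := arcsin_p_ltr s t.
rewrite !in_itv/= in s01 *; rewrite E !ltxx.
by move=> /(_ s01 t01) st /(_ t01 s01) ts; apply/eqP; rewrite eq_le !leNgt -st -ts.
Qed.

(** The intermediate value theorem gives a preimage in [0, 1]; the endpoints are excluded because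
    their images are the excluded ends of the interval of [x]. *)
Lemma sin_p_itv (x : R) : x \in `]0, arcsin_p p 1[ ->
  0 < sin_p p x < 1 /\ arcsin_p p (sin_p p x) = x.
Proof.
rewrite in_itv/= => /andP[x0 x1].
have [|s s01 sx] := @IVT R (arcsin_p p) 0 1 x ler01 arcsin_p_continuous.
  by rewrite arcsin_p0 min_l ?max_r ?(ltW A1_gt0)// !ltW.
rewrite -sx arcsin_pK//; split=> //.
move: s01 x0 x1; rewrite -sx in_itv/= => /andP[].
rewrite !le_eqVlt => /predU1P[<-|->]; first by rewrite arcsin_p0 ltxx.
by move=> /predU1P[->|->]; rewrite ?ltxx.
Qed.

Lemma sin_p_le : {in `]0, arcsin_p p 1[ &, {homo sin_p p : x y / x <= y}}.
Proof.
move=> x y /sin_p_itv[/andP[sx0 sx1] xE] /sin_p_itv[/andP[sy0 sy1] yE].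
apply: contra_le => yx; rewrite -xE -yE arcsin_p_ltr// in_itv/= ?ltW//.
Qed.

Lemma sin_p_le_id (x : R) : x \in `]0, arcsin_p p 1[ -> sin_p p x <= x.
Proof.
move=> /sin_p_itv[/andP[s0 s1] xE].
by have := arcsin_p_expand _ _ (lexx 0) s0 (ltW s1); rewrite arcsin_p0 !subr0 xE.
Qed.

(** The inverse function rule gives 1 / h(sin_p(x)). The derivative is written as a power here
    because [cos_p] is defined as the derivative, and its closed form is read off from this
    result. *)
Let is_derive_sin_p_powR : {in `]0, arcsin_p p 1[, forall x : R,
  is_derive x 1 (sin_p p) ((1 - sin_p p x `^ p) `^ p^-1)}.
Proof.
move=> x /sin_p_itv[/[dup] s01 /andP[s0 s1] xE].
have near01 : \forall t \near sin_p p x, t \in `]0, 1[.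
  by apply: near_in_itvoo; rewrite in_itv.
have hs0 : 0 < h (sin_p p x).
  by rewrite powR_gt0// subr_gt0 powR_lt1// s1 ltW.
have -> : (1 - sin_p p x `^ p) `^ p^-1 = (h (sin_p p x))^-1.
  by rewrite /h powRN invrK.
rewrite -[X in is_derive X]xE.
apply: (@is_derive_inverse R (arcsin_p p)).
- near=> t; apply: arcsin_pK; apply: subset_itv_oo_cc; near: t; exact: near01.
- near=> t; apply: is_derive_continuous (is_derive_arcsin_p t _).
  suff : t \in `]0, 1[ by rewrite in_itv.
  by near: t; exact: near01.
- exact: is_derive_arcsin_p.
- by rewrite gt_eqF.
Unshelve. all: by end_near. Qed.

Lemma cos_pE : {in `]0, arcsin_p p 1[, forall x : R,
  cos_p p x = (1 - sin_p p x `^ p) `^ p^-1}.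
Proof. by move=> x /is_derive_sin_p_powR[_]; rewrite /cos_p derive1E. Qed.

Lemma is_derive_sin_p : {in `]0, arcsin_p p 1[, forall x : R,
  is_derive x 1 (sin_p p) (cos_p p x)}.
Proof. by move=> x xP; rewrite cos_pE//; exact: is_derive_sin_p_powR. Qed.

Lemma cos_p_itv (x : R) : x \in `]0, arcsin_p p 1[ -> 0 < cos_p p x <= 1.
Proof.
move=> xP; rewrite cos_pE//; have [/andP[s0 s1] _] := sin_p_itv x xP.
have sp1 : sin_p p x `^ p < 1 by rewrite powR_lt1// s1 ltW.
rewrite powR_gt0 ?subr_gt0// powR_le1 ?invr_ge0 ?(ltW p0)//.
by rewrite subr_ge0 (ltW sp1) gerBl powR_ge0.
Qed.

Lemma sin_p_cos_p (x : R) : x \in `]0, arcsin_p p 1[ ->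
  sin_p p x `^ p + cos_p p x `^ p = 1.
Proof.
move=> xP; rewrite cos_pE//; have [/andP[s0 s1] _] := sin_p_itv x xP.
have sp1 : sin_p p x `^ p < 1 by rewrite powR_lt1// s1 ltW.
rewrite -powRrM mulVf ?gt_eqF// powRr1 ?subr_ge0 ?(ltW sp1)//.
by rewrite addrC subrK.
Qed.

Lemma cos_p_le : {in `]0, arcsin_p p 1[ &,
  {homo cos_p p : x y / x <= y >-> y <= x}}.
Proof.
move=> x y xP yP xy; rewrite (cos_pE x xP) (cos_pE y yP).
have [/andP[sx0 sx1] _] := sin_p_itv x xP.
have [/andP[sy0 sy1] _] := sin_p_itv y yP.
have w (z : R) : 0 < z -> z < 1 -> 0 <= 1 - z `^ p.
  by move=> z0 z1; rewrite subr_ge0 ltW// powR_lt1// z1 ltW.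
apply: ge0_ler_powR; rewrite ?nnegrE ?w ?invr_ge0 ?(ltW p0)//.
rewrite lerB// ge0_ler_powR ?nnegrE ?(ltW p0) ?(ltW sx0) ?(ltW sy0)//.
exact: sin_p_le.
Qed.

Lemma is_derive_cos_p : {in `]0, arcsin_p p 1[, forall x : R,
  is_derive x 1 (cos_p p) (- (sin_p p x `^ (p - 1) * cos_p p x `^ (2 - p)))}.
Proof.
move=> x xP; have [/andP[s0 s1] _] := sin_p_itv x xP.
have sp1 : sin_p p x `^ p < 1 by rewrite powR_lt1// s1 ltW.
have /andP[c0 _] := cos_p_itv x xP.
have D := @is_derive1_comp R _ (sin_p p) x _ _
  (is_derive1_one_sub_powR p p^-1 _ s0 sp1) (is_derive_sin_p x xP).
(* The closed form of [cos_p] holds on the open interval, hence near [x], which suffices for the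
   derivative. *)
apply: (near_eq_is_derive (f := fun y => (1 - sin_p p y `^ p) `^ p^-1)).
  near=> y; rewrite cos_pE//; near: y; exact: near_in_itvoo xP.
apply: (is_derive_eq D).
have -> : 1 - sin_p p x `^ p = cos_p p x `^ p.
  by rewrite -(sin_p_cos_p x xP) addrC addKr.
(* The power of c = cos_p(x) is p (1/p - 1) = 1 - p; the chain rule factor c raises it to 2 - p. *)
rewrite -powRrM mulrBr mulfV ?gt_eqF// mulr1 mulNr; congr (- _).
have -> : 2 - p = 1 - p + 1 by ring.
rewrite (powRD (r := 1 - p)) ?(gt_eqF c0) ?implybT// powRr1 ?(ltW c0)//.
by field; rewrite gt_eqF.
Unshelve. all: by end_near. Qed.

End arcsin_p_theory.

(** * Logarithmic means of generalized sines and cosines *)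

Section logmean_sin_cos.
Context {R : realType} (p : R).
Hypothesis p1 : 1 < p.
Hypothesis A1_gt0 : 0 < arcsin_p p 1.

Let I := `]0, arcsin_p p 1[.

Let I_gt0 : {in I, forall x : R, 0 < x}.
Proof. by move=> x; rewrite in_itv/= => /andP[]. Qed.

Let sin_gt0 : {in I, forall x : R, 0 < sin_p p x}.
Proof. by move=> x /(sin_p_itv p p1 A1_gt0)[/andP[]]. Qed.

Let cos_gt0 : {in I, forall x : R, 0 < cos_p p x}.
Proof. by move=> x /(cos_p_itv p p1 A1_gt0)/andP[]. Qed.

Lemma sin_p_inj : {in I &, injective (sin_p p)}.
Proof.
move=> x y /(sin_p_itv p p1 A1_gt0)[_ xE] /(sin_p_itv p p1 A1_gt0)[_ yE] E.
by rewrite -xE -yE E.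
Qed.

Lemma cos_p_inj : {in I &, injective (cos_p p)}.
Proof.
move=> x y xI yI E; apply: sin_p_inj => //.
apply: (@powR_injective R p).
- exact: lt_trans p1.
- by rewrite nnegrE ltW ?sin_gt0.
- by rewrite nnegrE ltW ?sin_gt0.
apply: (addIr (cos_p p x `^ p)).
by rewrite [in RHS]E !sin_p_cos_p.
Qed.

(* The derivative of x cot_p(x) has the sign of c s - x c^(2-p), where
   s = sin_p(x) <= x and c = cos_p(x) = c^(2-p) c^(p-1) <= c^(2-p). *)
Lemma mul_cot_p_nonincreasing :
  {in I &, {homo (fun x => x * cos_p p x / sin_p p x) : x y / x <= y >-> y <= x}}.
Proof.
pose dg x := (cos_p p x * sin_p p x - x * cos_p p x `^ (2 - p)) / sin_p p x ^+ 2.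
have gD : {in I, forall x : R,
    is_derive x 1 (fun x => x * cos_p p x / sin_p p x) (dg x)}.
  move=> x xI.
  have s0 := sin_gt0 x xI; have c0 := cos_gt0 x xI.
  have sD := is_derive_sin_p p p1 A1_gt0 x xI.
  have sVD := is_deriveV (lt0r_neq0 s0) sD.
  have cD := is_derive_cos_p p p1 A1_gt0 x xI.
  have D := is_deriveM (is_deriveM (is_derive_id x (1 : R)) cD) sVD.
  apply: (is_derive_eq D); rewrite !scaleRE.
  have sE : sin_p p x `^ p = sin_p p x * sin_p p x `^ (p - 1).
    by rewrite mulr_powRB1 ?ltW//; exact: lt_trans p1.
  have cE : cos_p p x ^+ 2 = cos_p p x `^ (2 - p) * cos_p p x `^ p.
    by rewrite -powRD ?(gt_eqF c0) ?implybT// subrK powR_mulrn ?ltW.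
  have := sin_p_cos_p p p1 A1_gt0 _ xI; rewrite sE /dg => E.
  (* The quotient rule produces x (s^p c^(2-p) + c^2) = x c^(2-p) (s^p + c^p), which collapses by
     s^p + c^p = 1. *)
  have -> : x * cos_p p x `^ (2 - p) = x * (sin_p p x * sin_p p x `^ (p - 1)
      * cos_p p x `^ (2 - p) + cos_p p x ^+ 2).
    by rewrite cE [X in x * (X + _)]mulrC -mulrDr E mulr1.
  by rewrite fctE /=; field; rewrite gt_eqF.
move=> x y xI yI; rewrite le_eqVlt => /predU1P[->//|xy].
have [z zxy] := MVT_itv _ dg I gD _ _ xI yI xy.
have zI : z \in I.
  move: zxy; rewrite in_itv/= => /andP[xz zy].
  by apply: (interval_is_interval xI yI); rewrite !ltW.
rewrite -subr_le0 => ->; rewrite pmulr_lle0 ?subr_gt0// /dg.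
rewrite pmulr_lle0 ?invr_gt0 ?exprn_gt0 ?sin_gt0// subr_le0.
have c0 := cos_gt0 z zI; have /andP[_ c1] := cos_p_itv p p1 A1_gt0 _ zI.
have cE : cos_p p z = cos_p p z `^ (2 - p) * cos_p p z `^ (p - 1).
  rewrite -powRD ?(gt_eqF c0) ?implybT//.
  have -> : 2 - p + (p - 1) = 1 by ring.
  by rewrite powRr1 ?ltW.
(* Cancelling c^(2-p) leaves s c^(p-1) <= z. *)
rewrite {1}cE mulrC mulrCA mulrC ler_pM2r ?powR_gt0//.
rewrite -[leRHS]mulr1 ler_pM ?powR_ge0 ?(ltW (sin_gt0 _ _))//.
  exact: sin_p_le_id.
by rewrite powR_le1 ?subr_ge0 ?(ltW p1) ?(ltW c0).
Qed.

Lemma logmean_sin_p : {in I &, forall x y : R,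
  logmean (sin_p p x) (sin_p p y) <= sin_p p (logmean x y)}.
Proof.
apply: (logmean_le _ (cos_p p)).
- exact: I_gt0.
- exact: sin_gt0.
- exact: sin_p_inj.
- exact: is_derive_sin_p.
- exact: cos_p_le.
- exact: mul_cot_p_nonincreasing.
Qed.

(** For p >= 2 the exponent 2 - p is nonpositive, so c^(2-p) grows as c decreases. Then s^(p-1)
    c^(2-p), and also its product with x / c, is a product of nonnegative nondecreasing factors; the
    negatives are the two quantities required to be nonincreasing. *)
Lemma logmean_cos_p : 2 <= p -> {in I &, forall x y : R,
  logmean (cos_p p x) (cos_p p y) <= cos_p p (logmean x y)}.
Proof.
move=> p2.
have s_le x y : x \in I -> y \in I -> x <= y ->
    sin_p p x `^ (p - 1) <= sin_p p y `^ (p - 1).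
  move=> xI yI xy; apply: ge0_ler_powR.
  - by rewrite subr_ge0 ltW.
  - by rewrite nnegrE ltW ?sin_gt0.
  - by rewrite nnegrE ltW ?sin_gt0.
  - exact: sin_p_le.
have c_le x y : x \in I -> y \in I -> x <= y ->
    cos_p p x `^ (2 - p) <= cos_p p y `^ (2 - p).
  move=> xI yI xy; apply: powR_nonincreasing.
  - by rewrite subr_le0.
  - exact: cos_gt0.
  - exact: cos_p_le.
have dc_le x y : x \in I -> y \in I -> x <= y ->
    sin_p p x `^ (p - 1) * cos_p p x `^ (2 - p) <=
    sin_p p y `^ (p - 1) * cos_p p y `^ (2 - p).
  by move=> xI yI xy; apply: ler_pM (powR_ge0 _ _) (powR_ge0 _ _)
    (s_le _ _ xI yI xy) (c_le _ _ xI yI xy).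
apply: (logmean_le _ (fun x => - (sin_p p x `^ (p - 1) * cos_p p x `^ (2 - p)))).
- exact: I_gt0.
- exact: cos_gt0.
- exact: cos_p_inj.
- exact: is_derive_cos_p.
- by move=> x y xI yI xy; rewrite lerN2; exact: dc_le.
- move=> x y xI yI xy; rewrite !(mulrN, mulNr) lerN2.
  have cx0 := cos_gt0 x xI; have cy0 := cos_gt0 y yI.
  have x0 := I_gt0 x xI; have dcx0 := mulr_ge0 (powR_ge0 (sin_p p x) (p - 1))
    (powR_ge0 (cos_p p x) (2 - p)).
  apply: ler_pM.
  + by apply: mulr_ge0 dcx0; exact: ltW.
  + by rewrite invr_ge0 ltW.
  + by apply: (ler_pM (ltW x0) dcx0 xy); exact: dc_le.
  + by rewrite lef_pV2 ?posrE//; exact: cos_p_le.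
Qed.

End logmean_sin_cos.

Theorem theorem1p5 (R : realType) (p x y : R) (hp : 1 < p)
    (hx : 0 < x < pi_p p / 2) (hy : 0 < y < pi_p p / 2) :
  logmean (sin_p p x) (sin_p p y) <= sin_p p (logmean x y) /\
  (2 <= p -> logmean (cos_p p x) (cos_p p y) <= cos_p p (logmean x y)).
Proof.
move: hx hy; rewrite /pi_p mulrC mulKf ?pnatr_eq0// => hx hy.
(* Since [x] lies strictly between 0 and pi_p / 2 = arcsin_p(1), the latter is positive, which gives
   integrability. *)
have A1_gt0 : 0 < arcsin_p p 1 by move: hx => /andP[/lt_trans]; apply.
by split=> [|p2]; [apply: logmean_sin_p|apply: logmean_cos_p];
  rewrite ?in_itv.
Qed.
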